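(* The inequality $g(\mathcal{T}_3,x)\le x(1-x)$ holds for all $x\in[0,1]$. In particular, $g(\mathcal{T}_3,(k-1)/k)=(k-1)/k^2$ for every positive integer $k$ with $k\equiv1$ or $3\pmod 6$.
   Context: A $3$-graph $\mathcal{H}$ is a finite vertex set $V(\mathcal{H})$ together with a set of $3$-element subsets (edges); $v(\mathcal{H})=|V(\mathcal{H})|$. The shadow is $\partial\mathcal{H}=\{A\in\binom{V(\mathcal{H})}{2}: A\subset B \text{ for some } B\in\mathcal{H}\}$. $\mathcal{T}_3$ is the collection of all $3$-graphs on at most $5$ vertices with $3$ edges $A,B,C$ such that $A\triangle B\subset C$; a $3$-graph is cancellative iff it is $\mathcal{T}_3$-free (contains no member of $\mathcal{T}_3$ as a not necessarily induced subgraph). Densities: $d(\mathcal{H})=|\mathcal{H}|/\binom{v(\mathcal{H})}{3}$, $d(\partial\mathcal{H})=|\partial\mathcal{H}|/\binom{v(\mathcal{H})}{2}$. A sequence $(\mathcal{H}_k)$ is good if $v(\mathcal{H}_k)\to\infty$ and both density limits exist; it realizes $(x,y)$ if $\lim d(\partial\mathcal{H}_k)=x$, $\lim d(\mathcal{H}_k)=y$. $\Omega(\mathcal{T}_3)$ is the set of points of $[0,1]^2$ realized by good sequences of cancellative $3$-graphs (a closed set), and $g(\mathcal{T}_3,x)=\max\{y:(x,y)\in\Omega(\mathcal{T}_3)\}$ for $x$ in the projection of $\Omega(\mathcal{T}_3)$ onto the first coordinate. *)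

(* Defs.v *)
From HB Require Import structures.
From mathcomp Require Import all_boot all_order all_algebra.
From mathcomp Require Import all_classical all_reals all_analysis.

Set Implicit Arguments.
Unset Strict Implicit.
Unset Printing Implicit Defensive.

Import Order.TTheory GRing.Theory Num.Theory.
Import numFieldNormedType.Exports.

Local Open Scope classical_set_scope.
Local Open Scope ring_scope.

(* [Finite.type] is too large a universe for [set graph3], so families of
   3-graphs are plain predicates [graph3 -> Prop]. *)
Record graph3 : Type := Graph3 {
  vertex : finType;
  edges : {set {set vertex}};
  edges_card : forall e : {set vertex}, e \in edges -> #|e| = 3%N
}.

Definition nvert (H : graph3) : nat := #|vertex H|.

Definition shadow (H : graph3) : {set {set vertex H}} :=
  [set A : {set vertex H} |
    (#|A| == 2%N) && [exists B in edges H, A \subset B]]%SET.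

Definition symdiff (T : finType) (A B : {set T}) : {set T} :=
  ((A :\: B) :|: (B :\: A))%SET.

(* Containment as a not necessarily induced subgraph. *)
Definition contains (H F : graph3) : Prop :=
  exists f : vertex F -> vertex H, injective f /\
    forall e : {set vertex F}, e \in edges F -> (f @: e)%SET \in edges H.

Definition is_free (FF : graph3 -> Prop) (H : graph3) : Prop :=
  forall F : graph3, FF F -> ~ contains H F.

(* [is_free T3] is cancellativity. *)
Definition T3 (F : graph3) : Prop :=
  (nvert F <= 5)%N /\
  exists A B C : {set vertex F},
    [/\ uniq [:: A; B; C], edges F = [set A; B; C]%SET
      & symdiff A B \subset C].

Section FeasibleRegion.
Variable R : realType.

(* For fewer than 3 (resp. 2) vertices the quotient is 0 / 0 = 0; this does not
   affect limits along sequences whose orders tend to infinity. *)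
Definition edge_density (H : graph3) : R :=
  #|edges H|%:R / 'C(nvert H, 3)%:R.

Definition shadow_density (H : graph3) : R :=
  #|shadow H|%:R / 'C(nvert H, 2)%:R.

Definition good (H : nat -> graph3) : Prop :=
  [/\ nvert (H k) @[k --> \oo] --> \oo,
      cvg (shadow_density (H k) @[k --> \oo])
    & cvg (edge_density (H k) @[k --> \oo])].

Definition realizes (H : nat -> graph3) (p : R * R) : Prop :=
  shadow_density (H k) @[k --> \oo] --> p.1 /\
  edge_density (H k) @[k --> \oo] --> p.2.

Definition feasible_region (FF : graph3 -> Prop) : set (R * R) :=
  [set p | [/\ 0 <= p.1 <= 1, 0 <= p.2 <= 1
    & exists H : nat -> graph3,
        [/\ good H, forall k, is_free FF (H k) & realizes H p]]].

Definition fiber (FF : graph3 -> Prop) (x : R) : set R :=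
  [set y | feasible_region FF (x, y)].

Definition is_max (A : set R) (y : R) : Prop :=
  A y /\ forall z, A z -> z <= y.

(* The maximum of the fiber over [x]; the default 0 is only used when
   there is no maximum, so a statement about [g FF x] carries content only
   together with [is_max (fiber FF x) (g FF x)]. *)
Definition g (FF : graph3 -> Prop) (x : R) : R := xget 0 (is_max (fiber FF x)).

End FeasibleRegion.

(* Main.v *)
(* Write d(uv) for the codegree of a pair and D(w) for the degree of w in the
   shadow.  In a cancellative 3-graph on n vertices, every edge uvw satisfies
   d(uv) + D(w) <= n, since no vertex of N(uv) is adjacent to w in the shadow.
   Dividing by d(uw) and summing over ordered edges, AM-GM for the ratios
   d(uv) / d(uw) and Cauchy-Schwarz for D give
   6 |H| n <= 2 |dH| (n^2 - 2 |dH|), which is y <= x (1 - x) in the limit.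
   Balanced blow-ups of Steiner triple systems on k points attain equality at
   x = (k - 1) / k; such systems come from the Bose and Skolem constructions.
   Fibers are nonempty because a subset of the triples of a Steiner system is
   cancellative, with arbitrary shadow density and vanishing edge density, and
   they have a maximum because the feasible region is closed. *)
Require Import Defs.
From HB Require Import structures.
From mathcomp Require Import all_boot all_order all_algebra.
From mathcomp Require Import all_classical all_reals all_analysis.
From mathcomp Require Import zify ring lra.
Import Order.TTheory GRing.Theory Num.Theory.
Import numFieldNormedType.Exports.
Local Open Scope ring_scope.

(** * Counting ordered pairs and triples *)

Lemma sum_bool {T : finType} (P : pred T) : (\sum_x P x = #|P|)%N.
Proof.
rewrite -sum1_card [RHS]big_mkcond; apply: eq_bigr => x _.
by rewrite unfold_in; case: (P x).
Qed.

Section FiniteSets.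
Context {T : finType}.
Implicit Types (u v w : T) (e : {set T}) (E : {set {set T}}).

Lemma set2_eq_card2 e u v : #|e| = 2%N ->
  ([set u; v]%SET == e) = (u \in e) && (v \in e :\ u)%SET.
Proof.
move=> e2; apply/eqP/andP => [eE|[ue]].
  move: e2; rewrite -eE cards2 !inE !eqxx /= orbT andbT eq_sym.
  by case: (v == u).
rewrite !inE => /andP[vu ve]; apply/eqP; rewrite eqEcard e2 cards2 eq_sym vu.
by rewrite finset.subUset !finset.sub1set ue ve.
Qed.

(** Listing a triple is three successive choices without repetition, from [e], [e :\ u] and
    [e :\ u :\ v]; this is what yields the factor 3! = 6 below. *)
Lemma set3_eq_card3 e u v w : #|e| = 3%N ->
  ([set u; v; w]%SET == e) =
  [&& u \in e, v \in (e :\ u)%SET & w \in (e :\ u :\ v)%SET].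
Proof.
move=> e3; apply/eqP/and3P => [eE|[ue]].
  move: e3; rewrite -eE finset.setUC cardsU1 cards2 !inE !eqxx /= !orbT /= !andbT.
  rewrite negb_or [u == v]eq_sym.
  by case: (w == u); case: (w == v); case: (v == u).
rewrite !inE => /andP[vu ve] /and3P[wv wu we]; apply/eqP.
rewrite eqEcard e3 finset.setUC cardsU1 cards2 !inE negb_or wv wu eq_sym vu.
by rewrite !finset.subUset !finset.sub1set ue ve we.
Qed.

Lemma card_setD1 e u n : #|e| = n.+1 -> u \in e -> #|(e :\ u)%SET| = n.
Proof. by move=> en ue; move: (cardsD1 u e); rewrite ue en add1n => -[]. Qed.

Lemma sum_set2_eq e : #|e| = 2%N ->
  (\sum_u \sum_v ([set u; v]%SET == e) = 2)%N.
Proof.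
move=> e2; transitivity (\sum_(u in e) 1)%N; last by rewrite sum1_card.
rewrite [RHS]big_mkcond; apply: eq_bigr => u _.
under eq_bigr do rewrite (set2_eq_card2 _ _ _ e2).
case: ifP => ue /=; last by rewrite big1.
by rewrite (sum_bool (mem (e :\ u)%SET)) (card_setD1 _ _ 1).
Qed.

Lemma sum_set3_eq e : #|e| = 3%N ->
  (\sum_u \sum_v \sum_w ([set u; v; w]%SET == e) = 6)%N.
Proof.
move=> e3; transitivity (\sum_(u in e) 2)%N; last by rewrite sum_nat_const e3.
rewrite [RHS]big_mkcond; apply: eq_bigr => u _.
under eq_bigr do under eq_bigr do rewrite (set3_eq_card3 _ _ _ _ e3).
case: ifP => ue /=; last by rewrite big1 // => v _; rewrite big1.
have e2 := card_setD1 _ _ 2 e3 ue.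
transitivity (\sum_(v in e :\ u) 1)%N; last by rewrite sum1_card.
rewrite [RHS]big_mkcond; apply: eq_bigr => v _.
case: ifP => ve; last by rewrite big1.
by rewrite (sum_bool (mem (e :\ u :\ v)%SET)) (card_setD1 _ _ 1).
Qed.

(** Membership as a sum of indicators, so that sums over vertices can be exchanged with the sum over
    [E]. *)
Lemma mem_sum_eq E e : ((e \in E) = \sum_(f in E) (e == f) :> nat)%N.
Proof.
case eE: (e \in E).
  by rewrite (big_setD1 e) //= eqxx big1 // => f; rewrite !inE eq_sym => /andP[/negPf ->].
by rewrite big1 // => f fE; case: eqP => // ef; rewrite ef fE in eE.
Qed.

Lemma sum_set2_mem E : (forall e, e \in E -> #|e| = 2%N) ->
  (\sum_u \sum_v ([set u; v]%SET \in E) = 2 * #|E|)%N.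
Proof.
move=> E2; rewrite mulnC -sum_nat_const.
under eq_bigr do under eq_bigr do rewrite mem_sum_eq.
under eq_bigr do rewrite exchange_big.
by rewrite exchange_big; apply: eq_bigr => e /E2 /sum_set2_eq.
Qed.

Lemma sum_set3_mem E : (forall e, e \in E -> #|e| = 3%N) ->
  (\sum_u \sum_v \sum_w ([set u; v; w]%SET \in E) = 6 * #|E|)%N.
Proof.
move=> E3; rewrite mulnC -sum_nat_const.
under eq_bigr do under eq_bigr do under eq_bigr do rewrite mem_sum_eq.
under eq_bigr do under eq_bigr do rewrite exchange_big.
under eq_bigr do rewrite exchange_big.
by rewrite exchange_big; apply: eq_bigr => e /E3 /sum_set3_eq.
Qed.

Lemma cards3_uniq u v w : (#|[set u; v; w]%SET| == 3%N) = uniq [:: u; v; w].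
Proof.
rewrite finset.setUC cardsU1 cards2 !inE /= !inE !negb_or !andbT [w == u]eq_sym [w == v]eq_sym.
by case: (u == v); case: (u == w); case: (v == w).
Qed.

End FiniteSets.

(** * Cancellative 3-graphs *)

Definition triple (H : graph3) (u v w : vertex H) : bool :=
  [set u; v; w]%SET \in edges H.

Definition adj (H : graph3) (u v : vertex H) : bool :=
  [exists w, triple H u v w].

Arguments triple {H} u v w.
Arguments adj {H} u v.

Section Triples.
Context {H : graph3}.
Implicit Types (u v w : vertex H) (A B C : {set vertex H}).

Lemma triple_uniq u v w : triple u v w -> uniq [:: u; v; w].
Proof. by move=> /edges_card /eqP; rewrite cards3_uniq. Qed.

Lemma triple_swap23 u v w : triple u v w = triple u w v.
Proof. by rewrite /triple finset.setUAC. Qed.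

Lemma sum_triple : (\sum_(u : vertex H) \sum_v \sum_w triple u v w = 6 * #|edges H|)%N.
Proof. exact/sum_set3_mem/edges_card. Qed.

Lemma shadow_card2 A : A \in shadow H -> #|A| = 2%N.
Proof. by rewrite inE => /andP[/eqP]. Qed.

Lemma mem_shadow u v : ([set u; v]%SET \in shadow H) = adj u v.
Proof.
rewrite inE cards2; apply/andP/existsP => [[uv /existsP[B /andP[BH uvB]]]|[w uvw]].
  have ueB : u \in B by apply: (fintype.subsetP uvB); rewrite !inE eqxx.
  have veB : v \in B by apply: (fintype.subsetP uvB); rewrite !inE eqxx orbT.
  have B3 := edges_card BH.
  have vB : v \in (B :\ u)%SET by rewrite !inE veB andbT eq_sym; move: uv; case: (u != v).
  have B1 := card_setD1 _ _ 1 (card_setD1 _ _ 2 B3 ueB) vB.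
  have [w wB] : exists w, w \in (B :\ u :\ v)%SET by apply/set0Pn; rewrite -card_gt0 B1.
  exists w; rewrite /triple.
  by have /eqP -> : ([set u; v; w]%SET == B) by rewrite set3_eq_card3 // ueB vB wB.
have := triple_uniq _ _ _ uvw; rewrite /= !inE negb_or -andbA => /and3P[uv _ _].
split; first by rewrite uv.
by apply/existsP; exists [set u; v; w]%SET; rewrite -/(triple u v w) uvw finset.subsetUl.
Qed.

Lemma sum_adj : (\sum_(u : vertex H) \sum_v adj u v = 2 * #|shadow H|)%N.
Proof.
rewrite -(sum_set2_mem _ shadow_card2).
by apply: eq_bigr => u _; apply: eq_bigr => v _; rewrite mem_shadow.
Qed.

End Triples.

Definition cancellative (H : graph3) : Prop :=
  forall u v w x y : vertex H,
    triple u v w -> triple u v x -> w != x -> ~~ triple w x y.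

(* If a triple [C] contains [symdiff A B] then [A] and [B] share a pair, which
   is why three distinct edges with [symdiff A B \subset C] have the shape
   [uvw], [uvx], [wxy]. *)
Lemma free_T3P (H : graph3) : is_free T3 H <-> cancellative H.
Proof.
split=> [freeH u v w x y uvw uvx wx|cancH F [_ [A [B [C [ABC FE sABC]]]]] [f [finj fE]]].
  (* The forbidden member lives on the subtype of vertices listed in [S], which has at most 5
     elements even if [y] repeats [u] or [v]. *)
  apply/negP => wxy; pose S := [:: u; v; w; x; y].
  pose pre (A : {set vertex H}) : {set {z | z \in S}} := (val @^-1: A)%SET.
  have preK (A : {set vertex H}) : {subset A <= S} -> (val @: pre A)%SET = A.
    move=> AS; apply/finset.setP => z; apply/imsetP/idP => [[t]|zA].
      by rewrite inE => tA ->.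
    by exists (exist _ z (AS z zA)); rewrite ?inE.
  pose A := [set u; v; w]%SET; pose B := [set u; v; x]%SET; pose C := [set w; x; y]%SET.
  have sub : [/\ {subset A <= S}, {subset B <= S} & {subset C <= S}].
    by split=> z; rewrite !inE => /orP[/orP[]|] /eqP ->; rewrite eqxx ?orbT.
  have {sub} [AK BK CK] : [/\ (val @: pre A)%SET = A, (val @: pre B)%SET = B
    & (val @: pre C)%SET = C].
    by case: sub => *; rewrite !preK.
  have imH e : e \in [set pre A; pre B; pre C]%SET -> (val @: e)%SET \in edges H.
    by rewrite !inE => /orP[/orP[]|] /eqP ->; rewrite ?AK ?BK ?CK.
  have e3 e : e \in [set pre A; pre B; pre C]%SET -> #|e| = 3%N.
    by move=> /imH /edges_card; rewrite card_imset //; exact: val_inj.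
  have := freeH (Graph3 e3); apply; last by exists val; split; [exact: val_inj|].
  split; first by rewrite /nvert /= card_sig (leq_trans (card_size S)).
  have [] := (triple_uniq _ _ _ uvw, triple_uniq _ _ _ uvx).
  rewrite /= !inE !negb_or !andbT => /andP[/andP[uv uw] vw] /andP[/andP[_ ux] vx].
  exists (pre A), (pre B), (pre C); split=> //.
    (* [w] separates [A] from [B]. If [C] equalled [A] or [B], it would contain both [u] and [v],
       and both would have to be [y]. *)
    rewrite /= !inE !negb_or !andbT -andbA; apply/and3P; split; apply/eqP => E.
    - have : w \in B by rewrite -BK -E AK !inE eqxx orbT.
      by rewrite !inE eq_sym (negPf uw) eq_sym (negPf vw) (negPf wx).
    - have : u \in C by rewrite -CK -E AK !inE eqxx.
      rewrite !inE (negPf uw) (negPf ux) /= => /eqP uy.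
      have : v \in C by rewrite -CK -E AK !inE eqxx orbT.
      by rewrite !inE (negPf vw) (negPf vx) -uy eq_sym (negPf uv).
    - have : u \in C by rewrite -CK -E BK !inE eqxx.
      rewrite !inE (negPf uw) (negPf ux) /= => /eqP uy.
      have : v \in C by rewrite -CK -E BK !inE eqxx orbT.
      by rewrite !inE (negPf vw) (negPf vx) -uy eq_sym (negPf uv).
  apply/fintype.subsetP => z; rewrite !inE.
  by case: (val z == u); case: (val z == v); case: (val z == w); case: (val z == x).
have [AF BF CF] : [/\ A \in edges F, B \in edges F & C \in edges F].
  by rewrite FE !inE !eqxx !orbT.
have [AB [A3 B3]] : A != B /\ #|A| = 3%N /\ #|B| = 3%N.
  by move: ABC; rewrite /= inE negb_or -andbA => /and3P[-> _ _]; rewrite !edges_card.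
(* The symmetric difference has 6 - 2t elements with t the size of [A :&: B]. It fits into [C], so t
   is at least 2, and [A != B] excludes t = 3. *)
have cAB : #|A :&: B|%SET = 2%N.
  have := subset_leq_card sABC; rewrite (edges_card CF).
  have := cardsID B A; have := cardsID A B; rewrite A3 B3 /symdiff => hB hA.
  rewrite cardsU; have -> : ((A :\: B) :&: (B :\: A) = finset.set0)%SET.
    by apply/finset.setP => z; rewrite !inE; case: (z \in A); case: (z \in B).
  rewrite cards0 subn0.
  have nAB : #|A :&: B|%SET != 3%N.
    apply: contra AB => /eqP AB3; rewrite eqEcard A3 B3 leqnn andbT.
    apply/finset.setIidPl; apply/eqP; rewrite eqEcard finset.subsetIl.
    by rewrite AB3 A3.
  move: hB hA nAB; rewrite [(B :&: A)%SET]finset.setIC; move: #|_| #|_| #|_| => a b c.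
  by move=> ? ? /eqP ? ?; lia.
have [u uAB] : exists u, u \in (A :&: B)%SET by apply/set0Pn; rewrite -card_gt0 cAB.
have AB1 := card_setD1 _ _ 1 cAB uAB.
have [v vAB] : exists v, v \in (A :&: B :\ u)%SET by apply/set0Pn; rewrite -card_gt0 AB1.
have third (E : {set vertex F}) : #|E| = 3%N -> (A :&: B \subset E)%SET ->
    exists w, E = [set u; v; w]%SET.
  move=> E3 sE; have uE := fintype.subsetP sE _ uAB.
  have vE : v \in (E :\ u)%SET.
    by move: vAB; rewrite 2!finset.in_setD1 => /andP[-> /(fintype.subsetP sE) ->].
  have E1 := card_setD1 _ _ 1 (card_setD1 _ _ 2 E3 uE) vE.
  have [w wE] : exists w, w \in (E :\ u :\ v)%SET by apply/set0Pn; rewrite -card_gt0 E1.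
  by exists w; apply/esym/eqP; rewrite set3_eq_card3 // uE vE wE.
have [w AE] := third A A3 (finset.subsetIl _ _).
have [x BE] := third B B3 (finset.subsetIr _ _).
have wx : w != x by apply: contraNneq AB => wx; rewrite AE BE wx.
have uA : uniq [:: u; v; w] by rewrite -cards3_uniq -AE A3.
have uB : uniq [:: u; v; x] by rewrite -cards3_uniq -BE B3.
have wC : w \in C.
  apply: (fintype.subsetP sABC); rewrite AE BE !inE eqxx !orbT /=.
  move: uA uB wx; rewrite /= !inE !negb_or !andbT [w == u]eq_sym [w == v]eq_sym.
  by move=> /andP[/andP[_ ->]] -> _ ->.
have xC : x \in (C :\ w)%SET.
  rewrite !inE eq_sym wx /=.
  apply: (fintype.subsetP sABC); rewrite AE BE !inE eqxx !orbT /= andbT.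
  move: uA uB wx; rewrite /= !inE !negb_or !andbT [x == u]eq_sym [x == v]eq_sym [x == w]eq_sym.
  by move=> _ /andP[/andP[_ ->]] -> ->.
have C1 := card_setD1 _ _ 1 (card_setD1 _ _ 2 (edges_card CF) wC) xC.
have [y yC] : exists y, y \in (C :\ w :\ x)%SET by apply/set0Pn; rewrite -card_gt0 C1.
have CE : C = [set w; x; y]%SET.
  by apply/esym/eqP; rewrite set3_eq_card3 ?(edges_card CF) // wC xC yC.
have fT a b c : [set a; b; c]%SET \in edges F -> triple (f a) (f b) (f c).
  by move=> /fE; rewrite /triple !imsetU !imset_set1.
apply: (negP (cancH (f u) (f v) (f w) (f x) (f y) _ _ _)); first by apply: fT; rewrite -AE.
- by apply: fT; rewrite -BE.
- by rewrite (inj_eq finj).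
- by apply: fT; rewrite -CE.
Qed.

(** * The edge bound *)

Lemma codeg_add_deg {H : graph3} (u v w : vertex H) :
  cancellative H -> triple u v w ->
  (\sum_x triple u v x + \sum_x adj x w <= nvert H)%N.
Proof.
move=> canH uvw; rewrite -big_split /= /nvert -sum1_card; apply: leq_sum => x _.
case uvx: (triple u v x); last by case: (adj x w).
suff -> : adj x w = false by [].
apply/existsP => -[y xwy]; move: (xwy).
(* Cancellativity speaks of distinct [x] and [w]; for [x = w] the triple [xwy] is degenerate. *)
have [xw|xw] := eqVneq x w.
  by move: xwy => /triple_uniq; rewrite xw /= inE eqxx.
by apply/negP/(canH _ _ _ _ _ uvx uvw).
Qed.

(** Cauchy-Schwarz against the constant function, read off from the nonnegative sum of squared
    deviations [n * f i - s]. *)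
Lemma sqr_sum_le {R : realFieldType} {T : finType} (f : T -> R) :
  (\sum_i f i) ^+ 2 <= #|T|%:R * \sum_i f i ^+ 2.
Proof.
have [T0|T0] := posnP #|T|.
  by rewrite big1 ?expr0n ?T0 ?mul0r // => i; have := fintype0 i; rewrite T0 => /(_ erefl).
set n := #|T|%:R; set s := \sum_i f i; set q := \sum_i f i ^+ 2.
have n0 : 0 < n by rewrite ltr0n.
have : 0 <= \sum_i (n * f i - s) ^+ 2 by apply: sumr_ge0 => i _; exact: sqr_ge0.
have -> : \sum_i (n * f i - s) ^+ 2 = n * (n * q - s ^+ 2).
  rewrite (eq_bigr (fun i => n ^+ 2 * f i ^+ 2 - 2 * n * s * f i + s ^+ 2)).
    2: by move=> i _; ring.
  rewrite big_split /= sumrB -!mulr_sumr sumr_const -/s -/q -mulr_natr -/n; ring.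
by rewrite pmulr_rge0 // subr_ge0.
Qed.

Lemma divr_add_inv_ge2 {R : realFieldType} (a b : R) :
  0 < a -> 0 < b -> 2 <= a / b + b / a.
Proof.
move=> a0 b0; rewrite -subr_ge0.
have -> : a / b + b / a - 2 = (a - b) ^+ 2 / (a * b) by field; rewrite !gt_eqF.
by rewrite divr_ge0 ?sqr_ge0 // mulr_ge0 // ltW.
Qed.

Section EdgeBound.
Context {H : graph3} (R : realFieldType).
Implicit Types u v w : vertex H.

Let e u v w : R := (triple u v w)%:R.
Let d u v : R := \sum_w e u v w.
Let deg w : R := \sum_u (adj u w)%:R.

Let e_ge0 u v w : 0 <= e u v w.
Proof. exact: ler0n. Qed.

Let d_gt0 u v w : triple u v w -> 0 < d u v.
Proof.
move=> uvw; rewrite /d (bigD1 w) //= ltr_pwDl ?sumr_ge0 //.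
by rewrite /e uvw.
Qed.

(** By the convention 0 / 0 = 0, normalising by the codegree gives the indicator of the shadow on
    all pairs, adjacent or not. *)
Let d_div u v : d u v / d u v = (adj u v)%:R.
Proof.
case uv: (adj u v).
  by move/existsP: uv => [w /d_gt0 uvw]; rewrite divff // gt_eqF.
rewrite /d big1 ?mul0r // => w _; rewrite /e.
by case uvw: (triple u v w) => //; move/existsP: uv => []; exists w.
Qed.

Let d_swap u w : d u w = \sum_v e u v w.
Proof. by apply: eq_bigr => v _; rewrite /e triple_swap23. Qed.

(* Sum [codeg(uv) + deg(w) <= n] over ordered edges [uvw] with weight
   [1 / codeg(uw)]: this makes [(u, w)] uniform over the ordered shadow, and the
   codegree ratios are paired up by AM-GM. *)
Lemma edges_le_shadow : cancellative H ->
  6 * #|edges H|%:R * (nvert H)%:R <=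
  2 * #|shadow H|%:R * ((nvert H)%:R ^+ 2 - 2 * #|shadow H|%:R) :> R.
Proof.
move=> canH; set n : R := (nvert H)%:R.
set E : R := 6 * _; set D : R := 2 * _.
have sum_e : \sum_u \sum_v \sum_w e u v w = E.
  rewrite /E -natrM -sum_triple natr_sum; apply: eq_bigr => u _.
  by rewrite natr_sum; apply: eq_bigr => v _; rewrite natr_sum.
have sum_a : \sum_(u : vertex H) \sum_w (adj u w)%:R = D :> R.
  by rewrite /D -natrM -sum_adj natr_sum; apply: eq_bigr => u _; rewrite natr_sum.
have wt u v w : e u v w * ((d u v + deg w) / d u w) <= e u v w * (n / d u w).
  rewrite /e; case uvw: (triple u v w); last by rewrite !mul0r.
  have uwv : triple u w v by rewrite triple_swap23.
  rewrite !mul1r ler_pM2r ?invr_gt0 ?(d_gt0 u w v) //.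
  rewrite /d /deg /e -!natr_sum -natrD ler_nat.
  exact: codeg_add_deg.
have sum_n : \sum_u \sum_v \sum_w e u v w * (n / d u w) = n * D.
  rewrite -sum_a mulr_sumr; apply: eq_bigr => u _.
  rewrite exchange_big mulr_sumr; apply: eq_bigr => w _.
  by rewrite -mulr_suml -d_swap mulrCA d_div.
have sum_deg : \sum_u \sum_v \sum_w e u v w * (deg w / d u w) = \sum_w deg w ^+ 2.
  rewrite (eq_bigr (fun u => \sum_w deg w * (adj u w)%:R)).
    by rewrite exchange_big; apply: eq_bigr => w _; rewrite -mulr_sumr expr2.
  move=> u _; rewrite exchange_big; apply: eq_bigr => w _.
  by rewrite -mulr_suml -d_swap mulrCA d_div.
pose X := \sum_u \sum_v \sum_w e u v w * (d u v / d u w).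
have X_swap : X = \sum_u \sum_v \sum_w e u v w * (d u w / d u v).
  apply: eq_bigr => u _; rewrite exchange_big; apply: eq_bigr => w _.
  by apply: eq_bigr => v _; rewrite /e triple_swap23.
(* Exchanging [v] and [w] inverts the ratio, so [X + X] collects a term of the form t + 1/t, at
   least 2, from every ordered edge. *)
have X_ge : E <= X.
  have : 2 * E <= X + X; last by lra.
  rewrite {2}X_swap -big_split -sum_e mulr_sumr; apply: ler_sum => u _.
  rewrite -big_split mulr_sumr; apply: ler_sum => v _.
  rewrite -big_split mulr_sumr; apply: ler_sum => w _.
  rewrite /= -mulrDr mulrC /e; case uvw: (triple u v w); last by rewrite !mul0r.
  by rewrite !mul1r divr_add_inv_ge2 ?(d_gt0 u v w) ?(d_gt0 u w v) // triple_swap23.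
have sum_deg1 : \sum_w deg w = D by rewrite -sum_a exchange_big.
have := sqr_sum_le deg; rewrite sum_deg1 -/n => cs.
have tot : E + \sum_w deg w ^+ 2 <= n * D.
  rewrite -sum_n -sum_deg (le_trans (lerD X_ge (lexx _))) // -big_split.
  apply: ler_sum => u _; rewrite -big_split; apply: ler_sum => v _.
  rewrite -big_split; apply: ler_sum => w _.
  by rewrite /= -mulrDr -mulrDl wt.
(* Multiplying [tot] by [n] lets [cs] enter, giving [n * E + D ^ 2 <= n ^ 2 * D]. *)
have n0 : 0 <= n by rewrite ler0n.
have := ler_wpM2l n0 tot; rewrite mulrDr => tot'.
by rewrite mulrBr; nra.
Qed.
End EdgeBound.

(** * Steiner triple systems *)

(** Steiner quasigroups, the algebraic form of Steiner triple systems: for [x != y], [op x y] is the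
    third point of the block through [x] and [y]. *)
Record steiner_op {K : Type} (op : K -> K -> K) : Prop := SteinerOp {
  sopxx : forall x, op x x = x;
  sopC : forall x y, op x y = op y x;
  sopK : forall x y, op x (op x y) = y
}.

Arguments sopxx {K op}.
Arguments sopC {K op}.
Arguments sopK {K op}.

(* [i, j |-> p (i + j)] is a commutative quasigroup on [Z]: idempotent on the
   elements of [low], and sending [(i, i)] to [i + h] on the others.  The lines
   on [Z * 'I_3] are, up to order, [{(i, c), (j, c), (p (i + j), c + 1)}] for
   [i != j], and [{(i, 0), (i, 1), (i, 2)}] for [i] in [low].  With [low] full
   this is Bose's construction.  In Skolem's one [low] is half of [Z], and the
   pairs [(i, c), (i + h, c + 1)] with [i] not in [low], left uncovered, are
   completed by an additional point. *)
Section HalfAddition.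
Context {Z : finZmodType} (p s : Z -> Z) (low : pred Z) (h : Z).
Hypotheses (pK : cancel p s) (sK : cancel s p).
Hypotheses (p_dbl : forall i, p (i + i) = if low i then i else i + h).

(** The third point of the block through [(i, c)] and [(j, c + 1)], found by solving [p (i + b) = j]
    for [b]. The solution [b = i] means a vertical block or an uncovered pair. *)
Definition below (i : Z) (c : 'I_3) (j : Z) : option (Z * 'I_3) :=
  let b := s j - i in
  if b != i then Some (b, c) else if low i then Some (i, c + 1 + 1) else None.

(** Two distinct levels among three cyclic ones are consecutive, so in the last branch [x] lies one
    level above [y]. *)
Definition partial_op (x y : Z * 'I_3) : option (Z * 'I_3) :=
  if y.2 == x.2 then
    if y.1 == x.1 then Some x else Some (p (x.1 + y.1), x.2 + 1)
  else if y.2 == x.2 + 1 then below x.1 x.2 y.1 else below y.1 y.2 x.1.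

Let I3 (c : 'I_3) : [/\ c + 1 + 1 + 1 = c, (c + 1 == c) = false & (c + 1 + 1 == c) = false].
Proof. by split; [apply/val_inj|..]; case: c => -[|[|[|]]]. Qed.

Let I3cases (c c' : 'I_3) : [\/ c' = c, c' = c + 1 | c = c' + 1].
Proof.
by case: c => -[|[|[|//]]] ?; case: c' => -[|[|[|//]]] ?;
  by [apply: Or31; apply/val_inj|apply: Or32; apply/val_inj|apply: Or33; apply/val_inj].
Qed.

Let below_K i c j y :
  below i c j = Some y -> partial_op (i, c) y = Some (j, c + 1) /\
                         partial_op (j, c + 1) y = Some (i, c).
Proof.
have [c3 c1 c2] := I3 c; rewrite /below; case: eqP => [sj|/eqP bi] /=.
  (* A block exists here only for [low i], and then it is the vertical one over [i = j]. *)
  have sjE : s j = i + i by rewrite -[X in _ = X + _]sj subrK.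
  have jE : j = if low i then i else i + h by rewrite -p_dbl -sjE sK.
  case: ifP => // li [<-]; rewrite jE li /partial_op /below /=.
  have sii : s i = i + i by rewrite -[RHS]pK p_dbl li.
  have [_ d1 _] := I3 (c + 1).
  by rewrite c2 d1 eqxx sii addrK eqxx c3 li.
move=> [<-]; rewrite /partial_op /= eqxx (negPf bi) /=; split.
  by rewrite addrC subrK sK.
rewrite [c == _]eq_sym c1 [c == _]eq_sym c2 /below /=.
by rewrite subKr eq_sym (negPf bi).
Qed.

Lemma partial_opC x y : partial_op x y = partial_op y x.
Proof.
case: x y => [i c] [j c']; have [c3 c1 c2] := I3 c; have [_ c1' c2'] := I3 c'.
rewrite /partial_op /=.
by case: (I3cases c c') => E; rewrite E ?eqxx;
   [rewrite eq_sym addrC; case: eqP => [->|]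
   |rewrite c1 [c == _]eq_sym c1 [c == _]eq_sym c2
   |rewrite c1' [c' == _]eq_sym c1' [c' == _]eq_sym c2'].
Qed.

Lemma partial_opxx x : partial_op x x = Some x.
Proof. by rewrite /partial_op !eqxx. Qed.

Lemma partial_opK x y z : partial_op x y = Some z -> partial_op x z = Some y.
Proof.
case: x y => [i c] [j c']; have [c3 c1 c2] := I3 c; have [_ c1' c2'] := I3 c'.
case: (I3cases c c') => E; rewrite E.
- rewrite {1}/partial_op /= eqxx; case: eqP => [-> [<-]|/eqP ji [<-]].
    by rewrite partial_opxx.
  by rewrite /partial_op /= c1 eqxx /below pK [i + j]addrC addrK ji.
- by rewrite {1}/partial_op /= c1 eqxx => /below_K[].
- rewrite {1}/partial_op /= eq_sym c1' eq_sym c2' => /below_K[].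
  by [].
Qed.

Section Complete.
Hypotheses (low_all : forall i, low i) .

Definition complete_op (x y : Z * 'I_3) : Z * 'I_3 := odflt x (partial_op x y).

(** [below] returns [None] only outside [low], so with [low] full every pair is covered. *)
Lemma complete_opE x y : partial_op x y = Some (complete_op x y).
Proof.
have tot i c j : isSome (below i c j) by rewrite /below low_all; case: ifP.
suff : isSome (partial_op x y) by rewrite /complete_op; case: (partial_op x y).
by rewrite /partial_op; case: ifP => _; [case: ifP|case: ifP; rewrite tot].
Qed.

Lemma complete_op_steiner : steiner_op complete_op.
Proof.
split=> x; first by rewrite /complete_op partial_opxx.
  by move=> y; apply: Some_inj; rewrite -!complete_opE partial_opC.
by move=> y; apply: Some_inj; rewrite -complete_opE; apply/partial_opK/complete_opE.
Qed.
End Complete.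

Section OnePoint.
Hypotheses (hh : h + h = 0) (lowh : forall i, low (i + h) = ~~ low i).

(** The other end of the uncovered pair through [x]. Such a pair climbs one level from outside [low]
    into [low], so from [low] the step is downwards, written [+ 1 + 1]. *)
Definition partner (x : Z * 'I_3) : Z * 'I_3 :=
  (x.1 + h, if low x.1 then x.2 + 1 + 1 else x.2 + 1).

Let partnerK x : partner (partner x) = x.
Proof.
case: x => i c; have [c3 _ _] := I3 c; rewrite /partner /= lowh -addrA hh addr0.
by case: (low i); rewrite /= c3.
Qed.

Let below_None i c j : below i c j = None -> ~~ low i /\ j = i + h.
Proof.
rewrite /below; case: eqP => //= sj; case: ifP => // /negbT li _; split=> //.
by rewrite -(sK j) -[s j](subrK i) sj p_dbl (negPf li).
Qed.

Let below_partner i c : ~~ low i -> below i c (i + h) = None.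
Proof.
move=> li; have -> : i + h = p (i + i) by rewrite p_dbl (negPf li).
by rewrite /below pK addrK eqxx (negPf li).
Qed.

Let partial_op_partner x : partial_op x (partner x) = None.
Proof.
case: x => i c; have [c3 c1 c2] := I3 c; have [_ d1 _] := I3 (c + 1).
rewrite /partner /partial_op /=; case li: (low i); rewrite ?c1 ?c2 ?d1 ?eqxx.
  by rewrite -[X in below _ _ X](addr0 i) -hh addrA below_partner // lowh li.
by rewrite below_partner ?li.
Qed.

Let partial_op_None x y : partial_op x y = None -> y = partner x.
Proof.
case: x y => [i c] [j c']; have [c3 c1 c2] := I3 c; have [c3' c1' c2'] := I3 c'.
case: (I3cases c c') => E; rewrite E /partial_op /partner /=.
- by rewrite eqxx; case: ifP.
- by rewrite c1 eqxx => /below_None[/negPf -> ->].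
- rewrite eq_sym c1' eq_sym c2' => /below_None[lj ->].
  by rewrite lowh lj c3' -addrA hh addr0.
Qed.

(** [None] is the additional point, with blocks [None], [x], [partner x]; the value [None] of
    [partial_op] on an uncovered pair is thus already the right third point. *)
Definition one_point_op (x y : option (Z * 'I_3)) : option (Z * 'I_3) :=
  match x, y with
  | None, None => None
  | None, Some y => Some (partner y)
  | Some x, None => Some (partner x)
  | Some x, Some y => partial_op x y
  end.

Lemma one_point_op_steiner : steiner_op one_point_op.
Proof.
split=> [[x|]|[x|] [y|]|[x|] [y|]] //=; rewrite ?partial_opxx ?partnerK //.
- exact: partial_opC.
- case E: (partial_op x y) => [z|] /=; first exact: partial_opK.
  by rewrite (partial_op_None _ _ E).
Qed.
End OnePoint.
End HalfAddition.

Lemma val_addZp {n : nat} (x y : 'I_n.+1) :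
  val (x + y) = (if x + y < n.+1 then x + y else x + y - n.+1)%N.
Proof.
rewrite /=; case: ifP => xy; first by rewrite modn_small.
have [xn yn] := (ltn_ord x, ltn_ord y).
by rewrite -[in LHS](subnK (_ : n.+1 <= x + y)%N) ?modnDr ?modn_small //; lia.
Qed.

Lemma bose_steiner (m : nat) :
  exists (K : finType) (op : K -> K -> K), #|K| = (6 * m + 3)%N /\ steiner_op op.
Proof.
pose Z : finZmodType := 'I_(m.*2).+1.
(* The order 2m + 1 is odd with m + 1 inverse to 2, so [p] is halving. *)
have halfK (x : Z) : x *+ m.+1 + x *+ m.+1 = x.
  rewrite -mulrnDr addSn addnS addnn mulrSr Zp_mulrn.
  have -> : inZp (x * (m.*2).+1) = 0 :> Z by apply/val_inj; rewrite /= modnMl.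
  by rewrite add0r.
exists (Z * 'I_3)%type, (complete_op (fun x : Z => x *+ m.+1) (fun x => x + x) predT).
split; first by rewrite card_prod !card_ord; lia.
by apply: (complete_op_steiner _ _ _ 0) => // x; rewrite ?addr0 ?mulrnDl halfK.
Qed.

Lemma skolem_steiner (m : nat) :
  exists (K : finType) (op : K -> K -> K), #|K| = (6 * m + 1)%N /\ steiner_op op.
Proof.
case: m => [|m].
  by exists unit, (fun _ _ => tt); rewrite card_unit; split=> //; split=> [[]|[] []|[] []].
pose Z : finZmodType := 'I_(m.*2.+1).+1.
(* [p] halves the even residues into the lower half and sends the odd ones to the upper half. As [h]
   is half the order, a double [i + i] goes to [i] for [i] in the lower half and to [i + h]
   otherwise. *)
pose p (x : Z) : Z := inord (x./2 + odd x * m.+1).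
pose s (x : Z) : Z := inord (if (x < m.+1)%N then x.*2 else (x - m.+1).*2.+1).
pose h : Z := inord m.+1; pose low (x : Z) := (x < m.+1)%N.
have Zlt (x : Z) : (x < m.*2.+2)%N by exact: ltn_ord.
have pE x : nat_of_ord (p x) = (x./2 + odd x * m.+1)%N by apply: inordK; have := Zlt x; lia.
have sE x : nat_of_ord (s x) = (if (x < m.+1)%N then x.*2 else (x - m.+1).*2.+1).
  by apply: inordK; have := Zlt x; case: ifP; lia.
have hE : nat_of_ord h = m.+1 by apply: inordK; lia.
have addE (x y : Z) : nat_of_ord (x + y) = (if x + y < m.*2.+2 then x + y else x + y - m.*2.+2)%N.
  exact: val_addZp.
exists (option (Z * 'I_3))%type, (one_point_op p s low h).
split; first by rewrite card_option card_prod !card_ord; lia.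
apply: one_point_op_steiner => [x|x|i||i]; rewrite /low; try apply: ord_inj.
- by rewrite sE pE; have := Zlt x; case: ifP; lia.
- by rewrite pE sE; have := Zlt x; case: ifP; lia.
- have := Zlt i; rewrite pE addE [RHS](fun_if (@nat_of_ord _)) addE hE.
  by do ! case: ifP; lia.
- by rewrite addE hE /=; case: ifP; lia.
- by have := Zlt i; rewrite addE hE; case: ifP; lia.
Qed.

Lemma steiner_op_exists (k : nat) :
  k = 1 %[mod 6] \/ k = 3 %[mod 6] ->
  exists (K : finType) (op : K -> K -> K), #|K| = k /\ steiner_op op.
Proof.
rewrite [k in exists _ _, _ = k /\ _](divn_eq k 6) mulnC => -[] ->.
  exact: skolem_steiner.
exact: bose_steiner.
Qed.

(** * Blow-ups and partial Steiner systems *)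

Section SteinerBlowUp.
Context {K T : finType} {op : K -> K -> K} (opS : steiner_op op).
Implicit Types (a b c : K * T).

Let line a b c : bool := (a.1 != b.1) && (c.1 == op a.1 b.1).

Let line_swap12 a b c : line a b c -> line b a c.
Proof. by rewrite /line eq_sym (sopC opS). Qed.

Let line_swap23 a b c : line a b c -> line a c b.
Proof.
move=> /andP[ab /eqP ca]; rewrite /line ca (sopK opS) eqxx andbT.
by apply: contra ab => /eqP aE; rewrite -[b.1](sopK opS a.1) -aE (sopxx opS).
Qed.

Let line_uniq a b c : line a b c -> uniq [:: a; b; c].
Proof.
move=> abc; have /andP[ac _] := line_swap23 _ _ _ abc.
have /andP[bc _] := line_swap23 _ _ _ (line_swap12 _ _ _ abc).
have /andP[ab _] := abc.
rewrite /= !inE negb_or !andbT -andbA.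
by apply/and3P; split; [apply: contraNneq ab|apply: contraNneq ac|apply: contraNneq bc] => ->.
Qed.

(** Each point [x] of [K] becomes the class of pairs with first component [x]; edges are the
    transversals of blocks. *)
Definition blowup_edges : {set {set K * T}} :=
  [set e | [exists a, exists b, exists c, line a b c && (e == [set a; b; c])]]%SET.

Lemma blowup_edges_card e : e \in blowup_edges -> #|e| = 3%N.
Proof.
rewrite inE => /existsP[a /existsP[b /existsP[c /andP[/line_uniq abc /eqP ->]]]].
by apply/eqP; rewrite cards3_uniq.
Qed.

Definition steiner_blowup : graph3 := Graph3 blowup_edges_card.

Lemma steiner_blowup_triple (a b c : vertex steiner_blowup) :
  triple a b c = (a.1 != b.1) && (c.1 == op a.1 b.1).
Proof.
apply/idP/idP => [abc|abc].
  have := triple_uniq _ _ _ abc; move: abc.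
  rewrite /triple inE => /existsP[a' /existsP[b' /existsP[c' /andP[abc' /eqP E]]]].
  have aE : a \in [set a'; b'; c']%SET by rewrite -E !inE eqxx.
  have bE : b \in [set a'; b'; c']%SET by rewrite -E !inE eqxx orbT.
  have cE : c \in [set a'; b'; c']%SET by rewrite -E !inE eqxx !orbT.
  move: aE bE cE {E}; rewrite !inE -!orbA.
  (* Distinctness leaves the six permutations of [a'], [b'], [c'], all generated by these two
     transpositions. *)
  have sw12 := line_swap12; have sw23 := line_swap23.
  do 3! [case/or3P => /eqP ->]; rewrite /= ?inE ?eqxx ?orbT ?andbF //= => _;
    rewrite -/(line _ _ _); auto.
rewrite /triple inE; apply/existsP; exists a; apply/existsP; exists b.
by apply/existsP; exists c; rewrite eqxx andbT.
Qed.

(** Two edges sharing a pair have their third vertices in one class, and no edge meets a class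
    twice. *)
Lemma steiner_blowup_cancellative : cancellative steiner_blowup.
Proof.
move=> u v w x y; rewrite !steiner_blowup_triple => /andP[_ /eqP w1] /andP[_ /eqP x1] _.
by rewrite w1 x1 eqxx.
Qed.

Lemma nvert_steiner_blowup : nvert steiner_blowup = (#|K| * #|T|)%N.
Proof. exact: card_prod. Qed.

Let sum_fst (F : K -> nat) : (\sum_(c : K * T) F c.1 = #|T| * \sum_x F x)%N.
Proof.
rewrite -(pair_bigA _ (fun x (_ : T) => F x)) big_distrr /=.
by apply: eq_bigr => x _; rewrite sum_nat_const.
Qed.

Let sum_eq (y : K) : (\sum_x (x == y) = 1)%N.
Proof. by rewrite (sum_bool (pred1 y)) card1. Qed.

Let sum_neq : (\sum_(a : K * T) \sum_(b : K * T) (a.1 != b.1) = #|K| * (#|K|).-1 * #|T| ^ 2)%N.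
Proof.
rewrite (eq_bigr (fun _ => #|T| * (#|K|).-1)%N).
  by rewrite sum_nat_const card_prod; lia.
move=> a _; rewrite (sum_fst (fun x => a.1 != x)) (sum_bool (fun x => a.1 != x)).
by congr (_ * _)%N; rewrite -(cardC1 a.1); apply: eq_card => x; rewrite !inE eq_sym.
Qed.

Lemma card_steiner_blowup_edges :
  (6 * #|edges steiner_blowup| = #|K| * (#|K|).-1 * #|T| ^ 3)%N.
Proof.
rewrite -sum_triple expnS mulnCA -sum_neq big_distrr /=; apply: eq_bigr => a _.
rewrite big_distrr /=; apply: eq_bigr => b _.
under eq_bigr do rewrite steiner_blowup_triple.
case: (a.1 != b.1) => /=; last by rewrite big1 ?muln0.
by rewrite (sum_fst (fun x => x == op a.1 b.1)) sum_eq.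
Qed.

Lemma card_steiner_blowup_shadow :
  (2 * #|shadow steiner_blowup| = #|K| * (#|K|).-1 * #|T| ^ 2)%N.
Proof.
rewrite -sum_adj -sum_neq; apply: eq_bigr => a _; apply: eq_bigr => b _; congr nat_of_bool.
apply/existsP/idP => [[w]|ab]; first by rewrite steiner_blowup_triple => /andP[].
by exists (op a.1 b.1, a.2); rewrite steiner_blowup_triple ab /=.
Qed.

End SteinerBlowUp.

(** Partial Steiner triple systems. *)
Definition linear_graph (H : graph3) : Prop :=
  forall u v w x : vertex H, triple u v w -> triple u v x -> w = x.

(** An adjacent pair lies in exactly one edge, so the counts of ordered adjacent pairs and of
    ordered edges agree termwise. *)
Lemma linear_shadow (H : graph3) : linear_graph H -> #|shadow H| = (3 * #|edges H|)%N.
Proof.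
move=> linH; apply/eqP; rewrite -(eqn_pmul2l (ltn0Sn 1)) mulnA -sum_adj -sum_triple.
apply/eqP/eq_bigr => u _; apply: eq_bigr => v _; case uv: (adj u v).
  have /existsP[w uvw] := uv; rewrite (bigD1 w) //= uvw big1 // => x xw.
  by apply/eqP; rewrite eqb0; apply: contra xw => uvx; apply/eqP/(linH u v).
rewrite big1 // => w _; case uvw: (triple u v w) => //.
by move/existsP: uv => []; exists w.
Qed.

Lemma linear_cancellative (H : graph3) : linear_graph H -> cancellative H.
Proof. by move=> linH u v w x y uvw /(linH u v w x uvw) ->; rewrite eqxx. Qed.

Lemma linear_subgraph (H : graph3) (m : nat) :
  linear_graph H -> (m <= #|edges H|)%N ->
  exists G : graph3, [/\ linear_graph G, nvert G = nvert H & #|edges G| = m].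
Proof.
move=> linH mE; pose E := [set e in take m (enum (edges H))]%SET.
have sE e : e \in E -> e \in edges H by rewrite inE => /mem_take; rewrite mem_enum.
exists (Graph3 (fun e eE => edges_card (sE e eE))); split=> //.
  by move=> u v w x /sE uvw /sE uvx; apply: linH uvw uvx.
rewrite cardsE; have /card_uniqP -> : uniq (take m (enum (edges H))).
  by rewrite take_uniq // enum_uniq.
by rewrite size_take_min -cardE; apply/minn_idPl.
Qed.

(** * Densities and the feasible region *)

Section Densities.
Local Open Scope classical_set_scope.
Variable R : realType.
Implicit Types (H : graph3) (FF : graph3 -> Prop) (p : R * R).

Lemma natr_bin2 n : 'C(n.+1, 2)%:R * 2 = n.+1%:R * (n.+1%:R - 1) :> R.
Proof.
rewrite -natrM -[2%N]/(2`!) bin_ffact ffactnS ffactn1 natrM.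
by rewrite [n.+1%:R in X in _ = _ * X]mulrSr addrK.
Qed.

Lemma natr_bin3 n :
  'C(n.+2, 3)%:R * 6 = n.+2%:R * (n.+2%:R - 1) * (n.+2%:R - 2) :> R.
Proof.
rewrite -natrM -[6%N]/(3`!) bin_ffact !ffactnS ffactn0 muln1 !natrM /=.
by rewrite -!natr1; ring.
Qed.

Lemma shadow_densityE H : (2 <= nvert H)%N ->
  shadow_density R H = (2 * #|shadow H|)%:R / ((nvert H)%:R * ((nvert H)%:R - 1)).
Proof.
rewrite /shadow_density; case: (nvert H) => [//|n] n1; rewrite -natr_bin2 natrM.
have C0 : 'C(n.+1, 2)%:R != 0 :> R by rewrite pnatr_eq0 -lt0n bin_gt0.
by field; rewrite C0.
Qed.

Lemma edge_densityE H : (3 <= nvert H)%N ->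
  edge_density R H = (6 * #|edges H|)%:R /
    ((nvert H)%:R * ((nvert H)%:R - 1) * ((nvert H)%:R - 2)).
Proof.
rewrite /edge_density; case: (nvert H) => [//|[//|n]] n1; rewrite -natr_bin3 natrM.
have C0 : 'C(n.+2, 3)%:R != 0 :> R by rewrite pnatr_eq0 -lt0n bin_gt0.
by field; rewrite C0.
Qed.

Let card_le_bin (T : finType) (E : {set {set T}}) k :
  (forall e, e \in E -> #|e| = k) -> 0 <= (#|E|%:R / 'C(#|T|, k)%:R : R) <= 1.
Proof.
move=> Ek; rewrite divr_ge0 //=; have [->|C0] := posnP 'C(#|T|, k).
  by rewrite invr0 mulr0.
rewrite ler_pdivrMr ?ltr0n // mul1r ler_nat -card_draws; apply: subset_leq_card.
by apply/fintype.subsetP => e /Ek ek; rewrite inE ek.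
Qed.

Lemma shadow_density_itv H : 0 <= shadow_density R H <= 1.
Proof. exact/card_le_bin/shadow_card2. Qed.

Lemma edge_density_itv H : 0 <= edge_density R H <= 1.
Proof. exact/card_le_bin/edges_card. Qed.

Lemma edge_density_le H : cancellative H -> (3 <= nvert H)%N ->
  edge_density R H <=
  shadow_density R H * (1 - shadow_density R H) + 3 / (nvert H)%:R.
Proof.
move=> canH n3; have := edges_le_shadow R canH.
have /andP[x0 x1] := shadow_density_itv H; have /andP[y0 y1] := edge_density_itv H.
have := edge_densityE H n3; have := shadow_densityE H (ltnW n3).
rewrite !natrM; move: x0 x1 y0 y1.
set x := shadow_density R H; set y := edge_density R H; set n : R := (nvert H)%:R.
set D := 2 * _; set E := 6 * _ => x0 x1 y0 y1 xE yE ED.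
have n3' : 3 <= n by rewrite ler_nat.
have DE : D = x * (n * (n - 1)) by rewrite xE divfK // gt_eqF // mulr_gt0; lra.
have EE : E = y * (n * (n - 1) * (n - 2)).
  by rewrite yE divfK // gt_eqF // !mulr_gt0; lra.
have : n ^+ 2 * (n - 1) * (y * (n - 2)) <= n ^+ 2 * (n - 1) * (x * (n - x * (n - 1))).
  move: ED; rewrite DE EE; set a := (X in X <= _); set b := (X in _ <= X -> _).
  by move=> ab; rewrite [X in X <= _](_ : _ = a) ?[X in _ <= X](_ : _ = b) // /a /b; ring.
rewrite ler_pM2l; last by rewrite !mulr_gt0 ?exprn_gt0; lra.
move=> le; rewrite -(ler_pM2r (_ : 0 < n)); last by lra.
by rewrite mulrDl divfK; [nra|rewrite gt_eqF //; lra].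
Qed.

(** Single large 3-graphs replace sequences, which makes closedness of the region immediate. *)
Definition approximable FF p : Prop := forall (eps : R) (N : nat), 0 < eps ->
  exists H, [/\ is_free FF H, (N <= nvert H)%N,
    `|p.1 - shadow_density R H| < eps & `|p.2 - edge_density R H| < eps].

Lemma feasible_regionP FF p : feasible_region FF p <-> approximable FF p.
Proof.
split=> [[_ _ [H [[Hn _ _] freeH [Hx Hy]]]] eps N e0|app].
  move/cvgrPdist_lt: Hx => /(_ _ e0) Hx; move/cvgrPdist_lt: Hy => /(_ _ e0) Hy.
  move/cvgnyPge: Hn => /(_ N) Hn.
  near \oo => k; exists (H k); split=> //; near: k; assumption.
have {app} /choice[H HP] (k : nat) : exists H, [/\ is_free FF H, (k <= nvert H)%N,
    `|p.1 - shadow_density R H| < k.+1%:R^-1 & `|p.2 - edge_density R H| < k.+1%:R^-1].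
  by apply: app; rewrite invr_gt0 ltr0n.
have cvgE (f : nat -> R) l : (forall k, `|l - f k| < k.+1%:R^-1) -> f k @[k --> \oo] --> l.
  move=> fl; apply/cvgrPdist_lt => eps e0; near=> k; apply: lt_trans (fl k) _.
  near: k; exact: near_infty_natSinv_lt (PosNum e0).
have Hx : shadow_density R (H k) @[k --> \oo] --> p.1 by apply: cvgE => k; case: (HP k).
have Hy : edge_density R (H k) @[k --> \oo] --> p.2 by apply: cvgE => k; case: (HP k).
have itv (f : nat -> R) l : (forall k, 0 <= f k <= 1) -> f k @[k --> \oo] --> l -> 0 <= l <= 1.
  move=> f01 fl; have fc : cvg (f k @[k --> \oo]) by apply/cvg_ex; exists l.
  rewrite -(cvg_lim (@Rhausdorff R) fl); apply/andP; split.
    by apply: limr_ge => //; near=> k; case/andP: (f01 k).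
  by apply: limr_le => //; near=> k; case/andP: (f01 k).
split.
- by apply: itv Hx => k; exact: shadow_density_itv.
- by apply: itv Hy => k; exact: edge_density_itv.
exists H; split=> [|k|]; [split|by case: (HP k)|by split].
- apply/cvgnyPge => N; near=> k; case: (HP k) => _ + _ _.
  by apply: leq_trans; near: k; exact: nbhs_infty_ge.
- by apply/cvg_ex; exists p.1.
- by apply/cvg_ex; exists p.2.
Unshelve. all: by end_near. Qed.
End Densities.

(** * Points of the region of cancellative 3-graphs *)

Section FeasibleRegionT3.
Variable R : realType.
Implicit Types x y z : R.

Lemma sparse_feasible x : 0 <= x <= 1 -> feasible_region T3 (x, 0).
Proof.
move=> /andP[x0 x1]; apply/feasible_regionP => eps N eps0 /=.
set q := (N + Num.trunc eps^-1).+1; set k := (6 * q + 3)%N.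
have [K [op [Kk opS]]] : exists (K : finType) (op : K -> K -> K), #|K| = k /\ steiner_op op.
  exact: bose_steiner.
(* With singleton classes the blow-up is the Steiner system itself. *)
pose H := @steiner_blowup K unit op opS.
have Hn : nvert H = k by rewrite nvert_steiner_blowup card_unit muln1.
have H6 : (6 * #|edges H| = k * k.-1)%N.
  by rewrite card_steiner_blowup_edges card_unit Kk exp1n muln1.
have linH : linear_graph H.
  move=> u v [w []] [x' []]; rewrite !steiner_blowup_triple /=.
  by move=> /andP[_ /eqP ->] /andP[_ /eqP ->].
set M := #|edges H| in H6; set r : R := k%:R.
have k3 : (3 <= k)%N by rewrite leq_addl.
have r4 : 4 <= r by rewrite ler_nat /k /q; lia.
have ME : r * (r - 1) = 6 * M%:R.
  by rewrite -natrM H6 natrM -/r -subn1 natrB ?(leq_trans _ k3).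
have r_eps : (r - 2)^-1 < eps.
  rewrite -[X in _ < X]invrK ltf_pV2 ?posrE ?invr_gt0 //; last by lra.
  have ei : 0 <= eps^-1 by rewrite invr_ge0 ltW.
  have /andP[_ h] := truncn_itv ei; apply: lt_le_trans h _.
  by rewrite /r -natrB ?(leq_trans _ k3) // ler_nat /k /q; lia.
have M0 : 0 < M%:R :> R by nra.
have M_eps : M%:R^-1 < eps.
  by apply: le_lt_trans r_eps; rewrite lef_pV2 ?posrE //; nra.
have xM0 : 0 <= x * M%:R by rewrite mulr_ge0 // ltW.
(* Keeping [e], the integer part of [x * M], edges gives shadow density [e / M], within [1 / M] of
   [x], and edge density at most [1 / (r - 2)]. *)
have /andP[e_le e_gt] := truncn_itv xM0.
move: (Num.trunc _) e_le e_gt => e e_le; rewrite -natr1 => e_gt.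
have eM : (e <= M)%N by rewrite -(ler_nat R) (le_trans e_le) // ler_piMl // ltW.
have [G [linG Gn GE]] := linear_subgraph H e linH eM.
exists G; split.
- exact/free_T3P/linear_cancellative.
- by rewrite Gn Hn /k /q; lia.
- rewrite shadow_densityE ?Gn ?Hn ?(leq_trans _ k3) // -/r (linear_shadow _ linG) GE.
  rewrite mulnA natrM ME -mulf_div divff ?mul1r ?pnatr_eq0 //.
  apply: le_lt_trans M_eps; rewrite ger0_norm ?subr_ge0 ?ler_pdivrMr //.
  by rewrite -(ler_pM2r M0) mulrBl divfK ?mulVf ?gt_eqF //; lra.
- rewrite edge_densityE ?Gn ?Hn // -/r GE natrM sub0r normrN ME invfM mulrA.
  have e0 : 0 <= e%:R :> R by [].
  rewrite ger0_norm ?divr_ge0 ?mulr_ge0 //; last by lra.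
  apply: le_lt_trans r_eps; rewrite ger_pMl ?invr_gt0; last by lra.
  by rewrite ler_pdivrMr ?mulr_gt0 // mul1r ler_pM2l // ler_nat.
Qed.

Lemma steiner_feasible (k : nat) : (0 < k)%N ->
  k = 1 %[mod 6] \/ k = 3 %[mod 6] ->
  feasible_region T3 ((k%:R - 1) / k%:R : R, (k%:R - 1) / k%:R ^+ 2).
Proof.
move=> k0 /steiner_op_exists [K [op [Kk opS]]]; apply/feasible_regionP => eps N eps0 /=.
set m := (N + Num.trunc (4 / eps) + 3)%N.
pose H := @steiner_blowup K 'I_m op opS.
have Hn : nvert H = (k * m)%N by rewrite nvert_steiner_blowup card_ord Kk.
have mn : (m <= k * m)%N by rewrite leq_pmull.
have n3 : (3 <= k * m)%N by rewrite (leq_trans _ mn) // leq_addl.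
have k1 : (k.-1)%:R = k%:R - 1 :> R by rewrite -subn1 natrB.
set n : R := (k * m)%:R; have nE : n = k%:R * m%:R by rewrite /n natrM.
have n3' : 3 <= n by rewrite ler_nat.
have r1 : 1 <= k%:R :> R by rewrite ler1n.
have m3 : 3 <= m%:R :> R by rewrite ler_nat leq_addl.
(* This bounds both errors: the densities exceed their limits by the factors n/(n-1) and
   n^2/((n-1)(n-2)), and n^2 - (n-1)(n-2) = 3n - 2 is at most 4(n-1). *)
have n_eps : 4 / (n - 2) < eps.
  rewrite ltr_pdivrMr; last by lra.
  rewrite mulrC -ltr_pdivrMr //.
  have /andP[_] := truncn_itv (ltW (divr_gt0 (ltr0n R 4) eps0)).
  move/lt_le_trans; apply; rewrite /n -natrB ?(leq_trans _ n3) // ler_nat.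
  by apply: leq_trans (leq_sub2r 2 mn); rewrite /m -addnBA // addn1 ltnS leq_addl.
exists H; split.
- exact/free_T3P/steiner_blowup_cancellative.
- by rewrite Hn (leq_trans _ mn) // /m; lia.
- rewrite shadow_densityE ?Hn ?(leq_trans _ n3) // card_steiner_blowup_shadow.
  rewrite -/n card_ord Kk 2!natrM natrX k1.
  apply: le_lt_trans n_eps.
  have -> : (k%:R - 1) / k%:R - k%:R * (k%:R - 1) * m%:R ^+ 2 / (n * (n - 1)) =
      - ((k%:R - 1) / k%:R / (n - 1)) :> R.
    by rewrite nE; field; rewrite -nE; apply/and3P; split; rewrite gt_eqF //; lra.
  rewrite normrN ger0_norm; last by rewrite !divr_ge0 //; lra.
  apply: ler_pM; rewrite ?invr_ge0 ?divr_ge0 //; try lra.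
    by rewrite ler_pdivrMr; lra.
  by rewrite lef_pV2 ?posrE; lra.
- rewrite edge_densityE ?Hn // card_steiner_blowup_edges.
  rewrite -/n card_ord Kk 2!natrM natrX k1.
  apply: le_lt_trans n_eps.
  have -> : (k%:R - 1) / k%:R ^+ 2 - k%:R * (k%:R - 1) * m%:R ^+ 3 / (n * (n - 1) * (n - 2)) =
      - ((k%:R - 1) / k%:R ^+ 2 * ((3 * n - 2) / (n - 1)) / (n - 2)) :> R.
    by rewrite nE; field; rewrite -nE; apply/and4P; split; rewrite gt_eqF //; lra.
  have b0 : 0 <= ((k%:R - 1) / k%:R ^+ 2 : R) by rewrite divr_ge0 ?exprn_ge0 //; lra.
  have b1 : ((k%:R - 1) / k%:R ^+ 2 : R) <= 1.
    rewrite ler_pdivrMr ?exprn_gt0 ?mul1r ?ltr0n //.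
    by apply: (@le_trans _ _ k%:R); [lra|rewrite expr2 ler_peMl].
  have c0 : 0 <= (3 * n - 2) / (n - 1) by rewrite divr_ge0 //; lra.
  have c4 : (3 * n - 2) / (n - 1) <= 4 by rewrite ler_pdivrMr; lra.
  rewrite normrN ger0_norm; last by rewrite divr_ge0 ?(mulr_ge0 b0 c0) //; lra.
  rewrite ler_pM2r ?invr_gt0; last by lra.
  by rewrite -[4]mul1r ler_pM.
Qed.

Lemma feasible_le x y : feasible_region T3 (x, y) -> y <= x * (1 - x).
Proof.
move=> feas; have [/= /andP[x0 x1] _ _] := feas; move/feasible_regionP: feas => app.
apply/ler_addgt0Pr => eps eps0.
(* The budget is [eps / 4] for [y], [eps / 4] for moving [x] in [x * (1 - x)], and [eps / 2] for the
   term [3 / n]. *)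
have [H [/free_T3P canH Hn /=]] := app (eps / 4)
  (Num.trunc (6 / eps) + 3)%N (divr_gt0 eps0 (ltr0n R 4)).
have n3 : (3 <= nvert H)%N by rewrite (leq_trans _ Hn) // leq_addl.
have := edge_density_le R H canH n3; have /andP[] := shadow_density_itv R H.
set X := shadow_density R H; set Y := edge_density R H; set n : R := (nvert H)%:R.
move=> X0 X1 YX; rewrite !ltr_norml => /andP[xl xu] /andP[yl yu].
have nn : 3 / n <= eps / 2.
  have n0 : 0 < n by rewrite ltr0n (leq_trans _ n3).
  have /andP[_ lt6] := truncn_itv (ltW (divr_gt0 (ltr0n R 6) eps0)).
  rewrite ler_pdivrMr // mulrC -ler_pdivrMr; last by lra.
  have -> : 3 / (eps / 2) = 6 / eps by field; rewrite gt_eqF.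
  apply: (le_trans (ltW lt6)).
  by rewrite ler_nat (leq_trans _ Hn) // -addn1 leq_add2l.
(* The map [x * (1 - x)] is 1-Lipschitz on the unit interval. *)
have : X * (1 - X) - x * (1 - x) <= eps / 4.
  have -> : X * (1 - X) - x * (1 - x) = (X - x) * (1 - X - x) by ring.
  by nra.
lra.
Qed.

(** The supremum is attained: a 3-graph within [eps / 2] of a fiber point that is itself
    [eps / 2]-close to the supremum approximates the supremum. *)
Lemma fiber_has_max x : 0 <= x <= 1 -> is_max (fiber T3 x) (g T3 x).
Proof.
move=> x01; apply: xgetPex; pose A := fiber T3 x.
have supA : has_sup A.
  split; first by exists 0; exact: sparse_feasible.
  by exists 1 => y [_ /andP[_]].
exists (sup A); split; last by move=> z; apply: sup_upper_bound.
apply/feasible_regionP => eps N eps0 /=.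
have e2 : 0 < eps / 2 by rewrite divr_gt0.
have [z Az zs] := sup_adherent e2 supA.
have zle : z <= sup A by exact: sup_upper_bound.
have [H [freeH Hn /= Hx Hz]] := (feasible_regionP R T3 (x, z)).1 Az (eps / 2) N e2.
exists H; split=> //; first by lra.
by move: Hz; rewrite !ltr_norml => /andP[? ?]; apply/andP; split; lra.
Qed.

End FeasibleRegionT3.

Theorem theorem1p15 (R : realType) :
  (forall x : R, 0 <= x <= 1 ->
     is_max (fiber T3 x) (g T3 x) /\ g T3 x <= x * (1 - x)) /\
  (forall k : nat, (0 < k)%N ->
     k = 1 %[mod 6] \/ k = 3 %[mod 6] ->
     g T3 ((k%:R - 1) / k%:R : R) = (k%:R - 1) / k%:R ^+ 2).
Proof.
split=> [x x01|k k0 kmod].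
  by have gmax := fiber_has_max R x x01; split; [|exact/feasible_le/gmax.1].
set x : R := _ / _.
have feas := steiner_feasible R k k0 kmod.
have x01 : 0 <= x <= 1 by case: feas.
have [gA gmax] := fiber_has_max R x x01.
apply/eqP; rewrite eq_le gmax // andbT (le_trans (feasible_le R _ _ gA)) //.
have k1 : 0 < k%:R :> R by rewrite ltr0n.
by rewrite le_eqVlt; apply/orP; left; apply/eqP; rewrite /x; field; rewrite gt_eqF.
Qed.
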